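(* Let $g$ be the Game of Life and $\Omega(g) = \bigcap_{n \geq 0} g^n(\{0,1\}^{\mathbb{Z}^2})$ its limit set. For all large enough $n$ there exist patterns $p, q \in \{0,1\}^{[0,n-1]^2}$ such that $p$ and $q$ appear in $\Omega(g)$, but $p \sqcup \sigma_{(0,\, n + \lfloor n/15 \rfloor)}(q)$ does not appear in $\Omega(g)$.
   Context: The Game of Life is the map $g : \{0,1\}^{\mathbb{Z}^2} \to \{0,1\}^{\mathbb{Z}^2}$ defined as follows. Let $K = \{-1,0,1\}^2 \setminus \{(0,0)\}$. For $x \in \{0,1\}^{\mathbb{Z}^2}$ and $\vec v \in \mathbb{Z}^2$, put $s = \sum_{\vec u \in K} x_{\vec v + \vec u}$. Then $g(x)_{\vec v} = 1$ if and only if ($x_{\vec v} = 0$ and $s = 3$) or ($x_{\vec v} = 1$ and $s \in \{2,3\}$). Intervals are discrete. A pattern is a function $p : \mathrm{dom}(p) \to \{0,1\}$ with $\mathrm{dom}(p) \subset \mathbb{Z}^2$; it appears in a set $X\subset \{0,1\}^{\mathbb{Z}^2}$ if some $x \in X$ satisfies $x|_{\mathrm{dom}(p)} = p$. For a pattern $q$ and $\vec v \in \mathbb{Z}^2$, $\sigma_{\vec v}(q)$ is the pattern with domain $\mathrm{dom}(q) - \vec v$ and values $\sigma_{\vec v}(q)_{\vec u} = q_{\vec v + \vec u}$. For patterns $p, q$ with disjoint domains, $p \sqcup q$ is the pattern with domain $\mathrm{dom}(p) \cup \mathrm{dom}(q)$ that restricts to $p$ and to $q$. *)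

(* Defs.v *)
From mathcomp Require Import all_boot all_order all_algebra.
From mathcomp Require Import all_classical.

Set Implicit Arguments.
Unset Strict Implicit.
Unset Printing Implicit Defensive.

Import Order.TTheory GRing.Theory Num.Theory.

Local Open Scope classical_set_scope.
Local Open Scope ring_scope.

Definition config : Type := int * int -> bool.

Definition moore : seq (int * int) :=
  [seq u <- [seq (i, j) | i <- [:: -1; 0; 1], j <- [:: -1; 0; 1]] | u != (0, 0)].

Definition life (x : config) : config := fun v =>
  let s := (\sum_(u <- moore) x (v + u)%R)%N in
  (~~ x v && (s == 3)%N) || (x v && (s \in [:: 2; 3])%N).

Definition limit_set (g : config -> config) : set config :=
  \bigcap_n (iter n g @` [set: config]).

(* A pattern is a partial function from int * int to bool; it is undefined
   where its value is None. *)
Definition pattern : Type := int * int -> option bool.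

Definition dom (p : pattern) : set (int * int) := [set v | p v != None].

Definition appears (p : pattern) (X : set config) : Prop :=
  exists2 x, X x & forall v, dom p v -> p v = Some (x v).

(* The domain of shift v q is dom q - v, so the pattern moves by - v. *)
Definition shift (v : int * int) (q : pattern) : pattern := fun u => q (v + u).

(* Only meaningful when dom p and dom q are disjoint; on a common point this
   total version takes the value of p. *)
Definition join (p q : pattern) : pattern :=
  fun v => if p v is Some b then Some b else q v.

Definition square (n : nat) : set (int * int) :=
  [set v | 0 <= v.1 <= n%:Z - 1 /\ 0 <= v.2 <= n%:Z - 1].

Lemma dom_join (p q : pattern) : dom (join p q) = dom p `|` dom q.
Proof.
apply/seteqP; split=> v; rewrite /dom /join /=; first by case: (p v); auto.
by case: (p v) => [b|] // [].
Qed.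

Lemma join_l (p q : pattern) v : dom p v -> join p q v = p v.
Proof. by rewrite /dom /join /=; case: (p v). Qed.

Lemma join_r (p q : pattern) v :
  dom p `&` dom q = set0 -> dom q v -> join p q v = q v.
Proof.
move=> pq0 qv; rewrite /join; case pv: (p v) => [b|//].
have : (dom p `&` dom q) v by split=> //; rewrite /dom /= pv.
by rewrite pq0.
Qed.

Lemma dom_shift_disjoint (n k : nat) (p q : pattern) :
  dom p = square n -> dom q = square n ->
  dom p `&` dom (shift (0, (n + k)%N%:Z) q) = set0.
Proof.
move=> dp dq; apply/seteqP; split=> // v [].
rewrite dp => -[_ /andP[v20 _]].
have -> : dom (shift (0, (n + k)%N%:Z) q) v = dom q ((0, (n + k)%N%:Z) + v) by [].
rewrite dq => -[_ /andP[_]] /=.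
rewrite lerBrDr PoszD -addrA -addrA gerDl => h.
have : 0 < k%:Z + (v.2 + 1) :> int by rewrite ltr_wpDl // ltr_wpDl.
by rewrite ltNge h.
Qed.

(* Main.v *)
(** Let [W] be the 8-periodic word 00010011.  The stripes [S_u (i, j) = W (i - j + u)]
    satisfy [life S_u = S_(u+3)], so they lie in the limit set.  The key fact is that a
    patch of [S_(u+3)] in [life y], 29 columns wide and 20 rows high, forces a cell of [y]
    in the row just below the patch to agree with [S_u].  So a rectangle of [S_u] in a
    configuration forces, [s] steps back in time, a rectangle of [S_(u-3s)] with [s] more
    rows at the bottom and with only [28 s] columns and [20 s] top rows fewer.  Mirror
    images of stripes grow upwards in the same way.  Let [p] be a square of stripes and [q]
    a square of mirrored stripes, [n / 15] rows below it.  After about [n / 30] steps back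
    the two forced rectangles share a row and are still wide; on that row [W] would be
    invariant under an odd shift, which it is not.

    The key fact is obtained by arc consistency.  For every 3-row window of [y] a finite
    superset of its possible contents is stored; it starts from the rule of life on 3 x 3
    windows, is pruned against the overlaps with the neighbouring windows, and passes to
    wider windows by joining horizontal neighbours.  At width 7 the bottom windows are
    left with a single possible value in their corner cell. *)

Require Import Defs.
From mathcomp Require Import all_boot all_order all_algebra.
From mathcomp Require Import all_classical.
From mathcomp Require Import zify.

Set Implicit Arguments.
Unset Strict Implicit.
Unset Printing Implicit Defensive.

Import GRing.Theory Num.Theory.

(** * Sets of bit sequences as tries *)

(* A trie is a set of bit sequences, the left branch being taken on [false]; [Any] accepts
   all continuations.  Only upper bounds matter below: no operation may lose a sequence,
   but it may add some. *)
Inductive trie := Void | Any | Node of trie & trie.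

Fixpoint accepts (t : trie) (s : seq bool) : bool :=
  match t, s with
  | Void, _ => false
  | Any, _ => true
  | Node a b, x :: s' => accepts (if x then b else a) s'
  | Node _ _, [::] => false
  end.

Definition node (a b : trie) : trie :=
  match a, b with Void, Void => Void | _, _ => Node a b end.

Fixpoint union (a b : trie) : trie :=
  match a, b with
  | Void, t | t, Void => t
  | Any, _ | _, Any => Any
  | Node a0 a1, Node b0 b1 => Node (union a0 b0) (union a1 b1)
  end.

Fixpoint meet (a b : trie) : trie :=
  match a, b with
  | Void, _ | _, Void => Void
  | Any, t | t, Any => t
  | Node a0 a1, Node b0 b1 => node (meet a0 b0) (meet a1 b1)
  end.

Fixpoint project (m : seq bool) (t : trie) {struct t} : trie :=
  match t, m with
  | Void, _ => Void
  | Any, _ | _, [::] => Any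
  | Node a b, true :: m' => node (project m' a) (project m' b)
  | Node a b, false :: m' => union (project m' a) (project m' b)
  end.

(** Prunes [t] to the sequences that the mask [m] sends into [p]. On an [Any] branch of [t] the
    pruning is mostly given up, which still leaves an upper bound. *)
Fixpoint restrict (m : seq bool) (t p : trie) {struct t} : trie :=
  match t, p with
  | Void, _ | _, Void => Void
  | Any, _ => Any
  | Node a b, _ =>
    match m with
    | [::] => t
    | true :: m' =>
      if p is Node c d then node (restrict m' a c) (restrict m' b d) else t
    | false :: m' => node (restrict m' a p) (restrict m' b p)
    end
  end.

Fixpoint join_at (k : nat) (t p : trie) : trie :=
  match k, t with
  | 0, _ => meet t p
  | _, Void => Void
  | _, Any => Any
  | k'.+1, Node a b => node (join_at k' a p) (join_at k' b p)
  end.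

Fixpoint tabulate (n : nat) (P : seq bool -> bool) : trie :=
  if n is n'.+1 then
    node (tabulate n' (fun s => P (false :: s))) (tabulate n' (fun s => P (true :: s)))
  else if P [::] then Any else Void.

Lemma accepts_node a b x s :
  accepts (node a b) (x :: s) = accepts (if x then b else a) s.
Proof. by case: a => [||a0 a1]; case: b => [||b0 b1]; case: x. Qed.

Lemma accepts_union a b s : accepts (union a b) s = accepts a s || accepts b s.
Proof.
elim: a b s => [||a0 IH0 a1 IH1] [||b0 b1] s //=; rewrite ?orbT ?orbF //.
by case: s => [|[] s].
Qed.

Lemma accepts_meet a b s : accepts (meet a b) s = accepts a s && accepts b s.
Proof.
elim: a b s => [||a0 IH0 a1 IH1] [||b0 b1] s //=; rewrite ?andbF ?andbT //.
case: s => [|x s]; last by rewrite accepts_node; case: x.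
by case: (meet a0 b0) => [||c0 c1]; case: (meet a1 b1).
Qed.

Lemma accepts_project m t s : accepts t s -> accepts (project m t) (mask m s).
Proof.
elim: t m s => [||a IHa b IHb] [|k m] [|x s] //=.
by case: k x => [] [] h; rewrite ?accepts_node ?accepts_union ?(IHa _ _ h) ?(IHb _ _ h) ?orbT.
Qed.

Lemma accepts_restrict m t p s :
  accepts t s -> accepts p (mask m s) -> accepts (restrict m t p) s.
Proof.
elim: t m p s => [||a IHa b IHb] m p s //; first by case: p.
case: s => [|x s] // h; case: m => [|[] m]; first by case: p.
- case: p => [||c d] // hp; rewrite /= accepts_node.
  by case: x h hp => h hp; [apply: IHb | apply: IHa].
- case: p => [||c d] // hp; rewrite /= accepts_node;
    by case: x h hp => h hp; [apply: IHb | apply: IHa].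
Qed.

Lemma accepts_join_at k t p s :
  accepts t s -> accepts p (drop k s) -> accepts (join_at k t p) s.
Proof.
elim: k t s => [|k IHk] t s; first by rewrite /= drop0 accepts_meet => ->.
case: t => [||a b] //; case: s => [|x s] //=; rewrite accepts_node.
by case: x; apply: IHk.
Qed.

Lemma accepts_tabulate n P s : size s = n -> accepts (tabulate n P) s = P s.
Proof.
elim: n P s => [|n IHn] P [|x s] //=; first by case: (P _).
by case=> sz; rewrite accepts_node; case: x; rewrite IHn.
Qed.

Lemma accepts_cat t s1 s2 : accepts t s1 -> accepts t (s1 ++ s2).
Proof. by elim: t s1 => [||a IHa b IHb] [|x s1] //=; case: x => h; auto. Qed.

Fixpoint evaluated (t : trie) : bool :=
  if t is Node a b then evaluated a && evaluated b else true.

(* [force] evaluates the whole trie before continuing.  It is a no-op logically, but keeps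
   call-by-need reduction from piling up suspended computations. *)
Definition force (A : Type) (t : trie) (k : trie -> A) : A :=
  if evaluated t then k t else k Any.

Lemma forceE (A : Type) t (k : trie -> A) : force t k = k t.
Proof.
rewrite /force; suff -> : evaluated t by [].
by elim: t => //= a -> b ->.
Qed.

(** * Arc consistency on a grid of windows *)

Section Sweep.

Variable w : nat.

(** Masks on the column-by-column code of [w.+1] columns: they drop the first column, the last
    column, the row of least index and the row of greatest index. *)
Let tail := nseq 3 false ++ nseq (3 * w) true.
Let init := nseq (3 * w) true.
Let lower := flatten (nseq w.+1 [:: false; true; true]).
Let upper := flatten (nseq w.+1 [:: true; true; false]).

Fixpoint rightward_from (t : trie) (row : seq trie) : seq trie :=
  if row is t' :: row' then
    force (restrict init t' (project tail t)) (fun t'' => t'' :: rightward_from t'' row')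
  else [::].

Definition rightward (row : seq trie) : seq trie :=
  if row is t :: row' then t :: rightward_from t row' else [::].

Fixpoint leftward (row : seq trie) : seq trie :=
  if row is t :: row' then
    let row'' := leftward row' in
    if row'' is t' :: _ then force (restrict tail t (project init t')) (cons^~ row'')
    else [:: t]
  else [::].

Definition horizontal (row : seq trie) : seq trie := leftward (rightward row).

Fixpoint vertical (m m' : seq bool) (row row' : seq trie) : seq trie :=
  match row, row' with
  | t :: r, t' :: r' => force (restrict m t (project m' t')) (cons^~ (vertical m m' r r'))
  | _, _ => [::]
  end.

Fixpoint downward_from (row : seq trie) (g : seq (seq trie)) : seq (seq trie) :=
  if g is row' :: g' then
    let row'' := horizontal (vertical upper lower row' row) in row'' :: downward_from row'' g'
  else [::].

Fixpoint upward (g : seq (seq trie)) : seq (seq trie) :=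
  if g is row :: g' then
    let g'' := upward g' in
    if g'' is row' :: _ then horizontal (vertical lower upper row row') :: g''
    else [:: horizontal row]
  else [::].

Definition sweep (g : seq (seq trie)) : seq (seq trie) :=
  if g is row :: g' then
    let row' := horizontal row in upward (row' :: downward_from row' g')
  else [::].

End Sweep.

Fixpoint widen_row (row : seq trie) : seq trie :=
  if row is t :: row' then
    if row' is t' :: _ then force (join_at 3 t t') (cons^~ (widen_row row')) else [::]
  else [::].

Definition widen : seq (seq trie) -> seq (seq trie) := map widen_row.

(* The contents of the 3 x w window at row [r] and column [c], column by column. *)
Fixpoint window (f : nat -> nat -> bool) (w r c : nat) : seq bool :=
  if w is w'.+1 then [:: f r c, f r.+1 c, f r.+2 c & window f w' r c.+1] else [::].

(* The count includes the centre, entry 4, whence the thresholds 3 and 4. *)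
Definition next_state (s : seq bool) : bool :=
  let k := count id s in (k == 3) || nth false s 4 && (k == 4).

(** * Soundness of pruning and widening *)

Section Sound.

Variable f : nat -> nat -> bool.

(** The invariant of all passes: the true windows of [f] are never excluded. *)
Fixpoint sound_row (w r c : nat) (row : seq trie) : bool :=
  if row is t :: row' then accepts t (window f w r c) && sound_row w r c.+1 row' else true.

Fixpoint sound (w r : nat) (g : seq (seq trie)) : bool :=
  if g is row :: g' then sound_row w r 0 row && sound w r.+1 g' else true.

Lemma window_rcons w r c :
  window f w.+1 r c = window f w r c ++ [:: f r (c + w); f r.+1 (c + w); f r.+2 (c + w)].
Proof.
elim: w c => [|w IHw] c; first by rewrite /= addn0.
by rewrite [in RHS]/= addnS -addSn -IHw.
Qed.

Lemma mask_init w r c : mask (nseq (3 * w) true) (window f w.+1 r c) = window f w r c.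
Proof.
elim: w c => [|w IHw] c //.
by rewrite mulnS !addSn add0n; congr [:: _, _, _ & _]; apply: IHw.
Qed.

Lemma mask_tail w r c :
  mask (nseq 3 false ++ nseq (3 * w) true) (window f w.+1 r c) = window f w r c.+1.
Proof.
suff sz v d : size (window f v r d) <= 3 * v by apply: mask_true (sz w c.+1).
by elim: v d => [|v IHv] d //; rewrite mulnS !ltnS.
Qed.

Lemma mask_overlap w r c :
  mask (flatten (nseq w [:: false; true; true])) (window f w r c) =
  mask (flatten (nseq w [:: true; true; false])) (window f w r.+1 c).
Proof. by elim: w c => [|w IHw] c //=; rewrite IHw. Qed.

Lemma sound_rightward_from w r c t row :
  accepts t (window f w.+1 r c) -> sound_row w.+1 r c.+1 row ->
  sound_row w.+1 r c.+1 (rightward_from w t row).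
Proof.
elim: row t c => [|t' row IHrow] t c //= ht /andP[ht' hrow]; rewrite forceE /=.
have ht'' : accepts (restrict (nseq (3 * w) true) t'
    (project (nseq 3 false ++ nseq (3 * w) true) t)) (window f w.+1 r c.+1).
  by apply: accepts_restrict => //; rewrite mask_init -mask_tail; apply: accepts_project.
by rewrite ht'' /=; apply: IHrow.
Qed.

Lemma sound_leftward w r c row :
  sound_row w.+1 r c row -> sound_row w.+1 r c (leftward w row).
Proof.
elim: row c => [|t row IHrow] c //= /andP[ht /IHrow].
case: (leftward w row) => [|t' row'] /= ; first by rewrite ht.
move=> /andP[ht' hrow']; rewrite forceE /= ht' hrow' !andbT.
apply: accepts_restrict => //; rewrite mask_tail -(mask_init w r c.+1).
exact: accepts_project.
Qed.

Lemma sound_horizontal w r c row :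
  sound_row w.+1 r c row -> sound_row w.+1 r c (horizontal w row).
Proof.
move=> h; apply: sound_leftward; case: row h => [|t row] //= /andP[ht hrow].
by rewrite ht; apply: sound_rightward_from.
Qed.

Lemma sound_vertical w r r' c m m' row row' :
  (forall c', mask m (window f w r c') = mask m' (window f w r' c')) ->
  sound_row w r c row -> sound_row w r' c row' ->
  sound_row w r c (vertical m m' row row').
Proof.
move=> hm; elim: row row' c => [|t row IHrow] [|t' row'] c //= /andP[ht hrow] /andP[ht' hrow'].
rewrite forceE /= IHrow // andbT; apply: accepts_restrict => //.
by rewrite hm; apply: accepts_project.
Qed.

Lemma sound_downward_from w r row g :
  sound_row w.+1 r 0 row -> sound w.+1 r.+1 g ->
  sound w.+1 r.+1 (downward_from w row g).
Proof.
elim: g row r => [|row' g IHg] row r //= hrow /andP[hrow' hg].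
set row'' := horizontal w _.
have hrow'' : sound_row w.+1 r.+1 0 row''.
  apply: sound_horizontal; apply: sound_vertical hrow' hrow => c'.
  exact: esym (mask_overlap w.+1 r c').
by rewrite hrow'' IHg.
Qed.

Lemma sound_upward w r g : sound w.+1 r g -> sound w.+1 r (upward w g).
Proof.
elim: g r => [|row g IHg] r //= /andP[hrow /IHg].
case: (upward w g) => [|row' g'] /=; first by rewrite sound_horizontal.
move=> /andP[hrow' hg']; rewrite hrow' hg' !andbT.
apply: sound_horizontal; apply: sound_vertical hrow hrow' => c'.
exact: (mask_overlap w.+1 r c').
Qed.

Lemma sound_sweep w r g : sound w.+1 r g -> sound w.+1 r (sweep w g).
Proof.
case: g => [|row g] // /andP[hrow hg].
apply: sound_upward; rewrite /= sound_horizontal //=.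
by apply: sound_downward_from => //; apply: sound_horizontal.
Qed.

Lemma sound_widen w r g : sound w r g -> sound w.+1 r (widen g).
Proof.
elim: g r => [|row g IHg] r //= /andP[hrow hg]; rewrite IHg // andbT.
elim: row 0 hrow => [|t [|t' row] IHrow] c // /andP[ht hrow].
rewrite -[widen_row _]/(force (join_at 3 t t') (cons^~ (widen_row (t' :: row)))) forceE.
apply/andP; split; last exact: IHrow.
case/andP: hrow => ht' _; apply: accepts_join_at; last by rewrite /= drop0.
by rewrite window_rcons accepts_cat.
Qed.

End Sound.

(** * The finite computation for the stripe word *)

Definition word : seq bool := [:: false; false; false; true; false; false; true; true].

Definition rule (b : bool) : trie := tabulate 9 (fun s => next_state s == b).

(* [7 * r] stands for [- r] modulo 8. *)
Definition box_target (r c : nat) : bool := nth false word ((c + 7 * r + 4) %% 8).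

Definition initial (X : nat -> nat -> bool) (dead alive : trie) (h w : nat) : seq (seq trie) :=
  [seq [seq if X r c then alive else dead | c <- iota 0 w] | r <- iota 0 h].

Lemma sound_initial f X dead alive h w :
  (forall r c, r < h -> c < w -> accepts (if X r c then alive else dead) (window f 3 r c)) ->
  sound f 3 0 (initial X dead alive h w).
Proof.
move=> hX; have hrow r c v : r < h -> c + v <= w ->
    sound_row f 3 r c [seq if X r c' then alive else dead | c' <- iota c v].
  elim: v c => [|v IHv] c // hr hc; apply/andP; split; [apply: hX | apply: IHv]; lia.
suff hgrid k r : r + k <= h -> sound f 3 r
    [seq [seq if X r' c then alive else dead | c <- iota 0 w] | r' <- iota r k].
  exact: hgrid.
by elim: k r => [|k IHk] r // hr; apply/andP; split; [apply: hrow | apply: IHk]; lia.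
Qed.

(* [sweep w] acts on windows of width [w.+1].  The size of the box and the schedule were
   found by experiment. *)
Definition refined : seq (seq trie) :=
  sweep 6 (sweep 6 (widen (widen (sweep 4 (widen (widen
    (initial box_target (rule false) (rule true) 20 22))))))).

Definition first_bit_is (b : bool) (t : trie) : bool :=
  match t with Node Void _ => b | Node _ Void => ~~ b | _ => false end.

Lemma first_bit_isP b t x s : accepts t (x :: s) -> first_bit_is b t -> x = b.
Proof. by case: t => [||[||? ?] [||? ?]] //=; case: x; case: b. Qed.

Definition forced_word : seq bool := [seq nth false word ((k + 3) %% 8) | k <- iota 0 8].

(** Evaluated by the kernel. Eight consecutive columns of the bottom row cover all phases of the
    stripe, so any cell can be placed at one of them. *)
Lemma refined_forced : all2 first_bit_is forced_word (take 8 (drop 2 (head [::] refined))).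
Proof. by vm_cast_no_check (erefl true). Qed.

Lemma box_forces f :
  (forall r c, r < 20 -> c < 22 -> next_state (window f 3 r c) = box_target r c) ->
  forall k, k < 8 -> f 0 (k + 2) = nth false word ((k + 3) %% 8).
Proof.
move=> hf.
have h0 : sound f 3 0 (initial box_target (rule false) (rule true) 20 22).
  apply: sound_initial => r c hr hc; rewrite -(hf r c hr hc).
  by case: ifP => e; rewrite accepts_tabulate // e.
have hg : sound f 7 0 refined.
  by do 2 apply: sound_sweep; do 2 apply: sound_widen; apply: sound_sweep; do 2 apply: sound_widen.
move: refined_forced hg; case: refined => [|row g] //.
rewrite [head _ _]/= => hc /andP[hrow _] k hk.
have hacc n c rw : sound_row f 7 0 c rw -> n < size rw ->
    accepts (nth Void rw n) (window f 7 0 (c + n)).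
  elim: rw n c => [|t rw IHrw] [|n] c //= /andP[ht h] hn; first by rewrite addn0.
  by rewrite addnS -addSn IHrw.
move: hc; rewrite all2E => /andP[/eqP sz /(all_nthP (false, Void))].
have szc : size forced_word = 8 by rewrite size_map.
move=> /(_ k); rewrite size_zip -sz szc minnn nth_zip //= => /(_ hk).
rewrite nth_take // nth_drop => hb.
(* The equality of sizes in [all2] ensures that [nth] reads an actual window here, not the default
   [Void]. *)
have szr : 2 + k < size row.
  move: sz; rewrite szc size_take size_drop; case: ltnP => [h _|_ h]; first by lia.
  by lia.
have := hacc _ _ _ hrow szr; rewrite add0n => h.
by rewrite (addnC k 2) (first_bit_isP h hb) (nth_map 0) ?size_iota // nth_iota.
Qed.

(** * Stripes, their mirror images and their predecessors *)

Local Open Scope ring_scope.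

Definition stripe_at (z : int) : bool := nth false word `|(z %% 8)%Z|%N.

Definition stripe (u : int) : config := fun v => stripe_at (v.1 - v.2 + u).

Lemma stripe_atE (r : nat) (z : int) :
  (z = r%:Z %[mod 8])%Z -> stripe_at z = nth false word (r %% 8)%N.
Proof. by rewrite /stripe_at => ->; rewrite modz_nat absz_nat. Qed.

Lemma life_window (y : config) (i j : int) (r c : nat) :
  life y (i + c.+1%:Z, j + r.+1%:Z) =
  next_state (window (fun r c => y (i + c%:Z, j + r%:Z)) 3 r c).
Proof.
rewrite /life /next_state /=.
have -> : moore = [:: (-1, -1); (-1, 0); (-1, 1); (0, -1); (0, 1); (1, -1); (1, 0); (1, 1)].
  by [].
have pred n (k : int) : k + n.+1%:Z + -1 = k + n%:Z by lia.
have succ n (k : int) : k + n%:Z + 1 = k + n.+1%:Z by lia.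
rewrite !big_cons big_nil.
have addE (a b a' b' : int) : (a, b) + (a', b') = (a + a', b + b') by [].
rewrite !addE !pred !succ !addr0.
by do 9 (case: (y _)).
Qed.

Lemma life_stripe (u : int) : life (stripe u) = stripe (u + 3).
Proof.
apply/funext => -[i j]; set z := i - j + u.
have [m hm zm] : exists2 m, (m < 8)%N & (z = m%:Z %[mod 8])%Z.
  exists `|(z %% 8)%Z|%N; first by rewrite -ltz_nat gez0_abs ?modz_ge0 // ltz_pmod.
  by rewrite gez0_abs ?modz_ge0 // modz_mod.
(* The summand 8 keeps the truncated subtraction of [r] exact. *)
have near (r c : nat) : (r <= 2)%N ->
    stripe u (i - 1 + c%:Z, j - 1 + r%:Z) = nth false word ((m + 8 + c - r) %% 8)%N.
  move=> hr; apply: stripe_atE => /=.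
  have -> : i - 1 + c%:Z - (j - 1 + r%:Z) + u = z + (c%:Z - r%:Z) by rewrite /z; lia.
  by rewrite -modzDml zm modzDml; apply/eqP; rewrite eqz_mod_dvd; apply/dvdzP; exists (-1); lia.
have -> : life (stripe u) (i, j) = life (stripe u) (i - 1 + 1%:Z, j - 1 + 1%:Z).
  by rewrite !subrK.
rewrite life_window /window !near //.
have -> : stripe (u + 3) (i, j) = nth false word ((m + 3) %% 8)%N.
  by apply: stripe_atE => /=; rewrite addrA -modzDml zm modzDml.
by case: m hm {zm near} => [|[|[|[|[|[|[|[|]]]]]]]].
Qed.

Definition reflect_config (x : config) : config := fun v => x (v.1, - v.2).

(** Reflection permutes a 3 x 3 window and fixes its centre, and [next_state] depends only on the
    count and the centre. *)
Lemma life_reflect (x : config) : life (reflect_config x) = reflect_config (life x).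
Proof.
apply/funext => -[i j].
have -> : life (reflect_config x) (i, j) = life (reflect_config x) (i - 1 + 1%:Z, j - 1 + 1%:Z).
  by rewrite !subrK.
have -> : reflect_config (life x) (i, j) = life x (i - 1 + 1%:Z, - j - 1 + 1%:Z).
  by rewrite !subrK.
rewrite !life_window /window /reflect_config /=.
have -> : - (j - 1 + 0%:Z) = - j - 1 + 2%:Z by lia.
have -> : - (j - 1 + 1%:Z) = - j - 1 + 1%:Z by lia.
have -> : - (j - 1 + 2%:Z) = - j - 1 + 0%:Z by lia.
by rewrite /next_state /=; do 9 (case: (x _)).
Qed.

Lemma iter_life_stripe (n : nat) (u : int) : iter n life (stripe u) = stripe (u + 3 * n%:Z).
Proof.
elim: n => [|n IHn]; first by rewrite mulr0 addr0.
by rewrite iterS IHn life_stripe; congr stripe; lia.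
Qed.

Lemma iter_life_reflect (n : nat) (x : config) :
  iter n life (reflect_config x) = reflect_config (iter n life x).
Proof. by elim: n => //= n ->; rewrite life_reflect. Qed.

Lemma limit_set_stripe (u : int) : limit_set life (stripe u).
Proof.
move=> n _; exists (stripe (u - 3 * n%:Z)) => //.
by rewrite iter_life_stripe subrK.
Qed.

Lemma limit_set_reflect (x : config) :
  limit_set life x -> limit_set life (reflect_config x).
Proof.
move=> hx n hn; have [y _ <-] := hx n hn.
by exists (reflect_config y) => //; rewrite iter_life_reflect.
Qed.

Lemma predecessor_stripe (y : config) (u i j : int) :
  (forall i' j', i - 8 <= i' <= i + 20 -> j + 1 <= j' <= j + 20 ->
     life y (i', j') = stripe (u + 3) (i', j')) ->
  y (i, j) = stripe u (i, j).
Proof.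
(* The box is placed so that [(i, j)] is at column [k + 2] of its bottom row, where the phase is
   [k + 3]; hence the 3 subtracted in [z]. As [k] runs from 0 to 7, the boxes span the columns from
   [i - 8] to [i + 20]. *)
move=> hy; set z := i - j + u - 3.
pose k := `|(z %% 8)%Z|%N.
have hk : k%:Z = (z %% 8)%Z by rewrite gez0_abs ?modz_ge0.
have k8 : (k < 8)%N by rewrite -ltz_nat hk ltz_pmod.
pose f (r c : nat) := y (i - (k + 2)%N%:Z + c%:Z, j + r%:Z).
have -> : y (i, j) = f 0%N (k + 2)%N by rewrite /f subrK addr0.
rewrite (@box_forces f) //.
  apply/esym/stripe_atE => /=.
  by rewrite (_ : i - j + u = z + 3) 1?PoszD ?hk ?modzDml // /z; lia.
move=> r c hr hc; rewrite /f -life_window hy; [|lia|lia].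
rewrite /stripe /=; apply: stripe_atE.
have [q hq] : exists q, z = k%:Z + 8 * q by exists (z %/ 8)%Z; rewrite hk; lia.
apply/eqP; rewrite eqz_mod_dvd; apply/dvdzP; exists (q - r%:Z).
by move: hq; rewrite /z; lia.
Qed.

Lemma iter_predecessor_stripe (s : nat) (y : config) (u a b c d : int) :
  (forall i j, a <= i <= b -> c <= j <= d -> iter s life y (i, j) = stripe u (i, j)) ->
  forall i j, a + 8 * s%:Z <= i <= b - 20 * s%:Z -> c - s%:Z <= j <= d - 20 * s%:Z ->
  y (i, j) = stripe (u - 3 * s%:Z) (i, j).
Proof.
elim: s y => [|s IHs] y hy i j hi hj.
  by rewrite mulr0 subr0 -hy //; lia.
apply: predecessor_stripe => i' j' hi' hj'.
rewrite (IHs (life y)); [congr stripe| move=> i'' j''; rewrite -iterSr; exact: hy| |]; lia.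
Qed.

(** * The two square patterns and the contradiction *)

Definition restriction (n : nat) (x : config) : pattern :=
  fun v => if (0 <= v.1 <= n%:Z - 1) && (0 <= v.2 <= n%:Z - 1) then Some (x v) else None.

Lemma dom_restriction (n : nat) (x : config) : dom (restriction n x) = square n.
Proof.
apply/seteqP; split=> v; rewrite /dom /restriction /square /=; last by case=> -> ->.
by case: ifP => // /andP[].
Qed.

Lemma appears_restriction (n : nat) (x : config) (X : set config) :
  X x -> appears (restriction n x) X.
Proof.
by move=> Xx; exists x => // v; rewrite /dom /restriction /=; case: ifP.
Qed.

(** An odd shift generates the integers modulo 8, so invariance would make [word] constant. The
    proof checks the 32 cases of [a] modulo 8 and [t] modulo 4. *)
Lemma stripe_at_odd_shift (a t : int) :
  (forall e : nat, (e < 8)%N -> stripe_at (a + e%:Z) = stripe_at (a + e%:Z + (2 * t + 1))) ->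
  False.
Proof.
have residue (d : nat) (z : int) : (0 < d)%N ->
    exists2 r : nat, (r < d)%N & exists q, z = r%:Z + q * d%:Z.
  move=> d0; exists `|(z %% d)%Z|%N.
    by rewrite -ltz_nat gez0_abs ?modz_ge0 ?ltz_pmod //; lia.
  by exists (z %/ d)%Z; rewrite gez0_abs ?modz_ge0; lia.
have [r hr [b ea]] := residue 8%N a isT; have [s hs [q et]] := residue 4%N t isT.
move=> h; have : all (fun e =>
    nth false word ((r + e) %% 8) == nth false word ((r + e + (2 * s + 1)) %% 8)) (iota 0 8).
  apply/allP => e; rewrite mem_iota => /h; rewrite (@stripe_atE (r + e)) => [->|].
    apply/eqP/stripe_atE/eqP; rewrite eqz_mod_dvd; apply/dvdzP; exists (b + q); lia.
  by apply/eqP; rewrite eqz_mod_dvd; apply/dvdzP; exists b; lia.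
by case: r hr {ea} => [|[|[|[|[|[|[|[|]]]]]]]] // _; case: s hs {et} => [|[|[|[|]]]].
Qed.

Theorem theorem9 :
  exists N : nat, forall n : nat, (N <= n)%N ->
    exists p q : pattern,
      [/\ dom p = square n, dom q = square n,
          appears p (limit_set life), appears q (limit_set life)
        & ~ appears (join p (shift (0%R, Posz (n + n %/ 15)%N) q)) (limit_set life)].
Proof.
(* Eight common columns remain if [28 * m + 8 <= n] for the [m] below; as [m <= n / 30 + 1], 600 is
   ample. *)
exists 600%N => n hn; set k := (n %/ 15)%N.
(* The phase cancels the displacement by [n + k]: seen in the mirror, the second square carries
   [stripe 1], whose phase has the other parity. *)
exists (restriction n (stripe 0)), (restriction n (reflect_config (stripe (1 - (n + k)%N%:Z)))).
split; try exact: dom_restriction.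
- exact/appears_restriction/limit_set_stripe.
- exact/appears_restriction/limit_set_reflect/limit_set_stripe.
(* The least [m] with [2 * m >= k + 1], so that both forced regions reach row [- m]. *)
pose m := (k %/ 2).+1; case=> x /(_ m I) [y _ yx] hx.
have lower i j : 0 <= i <= n%:Z - 1 -> 0 <= j <= n%:Z - 1 ->
    iter m life y (i, j) = stripe 0 (i, j).
  move=> hi hj; have := hx (i, j).
  by rewrite yx /dom /join /restriction /= hi hj /= => /(_ isT) [].
have upper i j : 0 <= i <= n%:Z - 1 -> k%:Z + 1 <= j <= (n + k)%N%:Z ->
    iter m life (reflect_config y) (i, j) = stripe 1 (i, j).
  move=> hi hj; have := hx (i, - j).
  rewrite iter_life_reflect yx /reflect_config /dom /join /shift /restriction /=.
  have -> : (0 <= - j <= n%:Z - 1) = false by lia.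
  rewrite andbF add0r hi /=.
  have -> : 0 <= (n + k)%N%:Z - j <= n%:Z - 1 by lia.
  move=> /(_ isT) [<-]; rewrite /stripe /=; congr stripe_at; lia.
(* At column [8 * m + e] of row [- m] the first stripe has phase [6 * m + e] and the mirrored one
   [4 * m + e + 1]. *)
apply: (@stripe_at_odd_shift (6 * m%:Z) (- m%:Z)) => e he.
have hi : 0 + 8 * m%:Z <= 8 * m%:Z + e%:Z <= n%:Z - 1 - 20 * m%:Z by rewrite /m /k; lia.
have hj : 0 - m%:Z <= - m%:Z <= n%:Z - 1 - 20 * m%:Z by rewrite /m /k; lia.
have hj' : k%:Z + 1 - m%:Z <= m%:Z <= (n + k)%N%:Z - 20 * m%:Z by rewrite /m /k; lia.
have := iter_predecessor_stripe upper hi hj'.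
rewrite /reflect_config /= (iter_predecessor_stripe lower hi hj) /stripe /= => h.
transitivity (stripe_at (8 * m%:Z + e%:Z - - m%:Z + (0 - 3 * m%:Z))); first by congr stripe_at; lia.
by rewrite h; congr stripe_at; lia.
Qed.
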